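(* Fix an integer $\Delta \geq 2$. Let $A \subseteq \{s,\ell,m,r\}^*$ be the CodeSet$^\Delta$ (defined in the context). Then the map sending a $T^\Delta$ tree to its codeword is a bijection from the set of all $T^\Delta$ trees onto the set $\{ s\delta : \delta \in A\}$ of words obtained by prefixing the letter $s$ to an element of $A$. In particular, every word $s\delta$ with $\delta\in A$ is the codeword of exactly one $T^\Delta$ tree.
   Context: A $T^\Delta$ tree is an unlabeled ordered (plane) rooted tree in which every node has at most $\Delta$ children; formally it has a root $r$ and, if it has more than one node, $r$ is joined to an ordered sequence of $j\le\Delta$ subtrees $T_1,\dots,T_j$, each recursively a $T^\Delta$ tree. The codeword of a $T^\Delta$ tree $T$ is the word over the alphabet $\{s,\ell,m,r\}$ obtained as follows: the root is labeled $s$; for every internal node, if it has exactly one child that child is labeled $s$, and otherwise its leftmost child is labeled $\ell$, its rightmost child is labeled $r$, and all children strictly between them are labeled $m$; the codeword is the sequence of labels read in pre-order (root, then subtrees from left to right). The CodeSet$^\Delta$ is the smallest set $A$ of words over $\{s,\ell,m,r\}$ such that: (1) the empty word $\epsilon$ is in $A$; (2) for all $x\in A$, $sx\in A$; (3) for all $2\le i\le\Delta$ and all $x_1,\dots,x_i\in A$, the word $\ell x_1 m x_2 m x_3 \cdots m x_{i-1} r x_i$ is in $A$. *)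

(* Defs.v *)
From HB Require Import structures.
From mathcomp Require Export all_boot.
From mathcomp Require Export boolp classical_sets functions.

Set Implicit Arguments.
Unset Strict Implicit.
Unset Printing Implicit Defensive.

Inductive letter := Ls | Ll | Lm | Lr.

Lemma letter_comparable : comparable letter.
Proof. by move=> x y; rewrite /decidable; decide equality. Qed.

HB.instance Definition _ := hasDecEq.Build letter (compareP letter_comparable).

Definition word := seq letter.

Inductive tree := Node of seq tree.

Fixpoint is_Ttree (Delta : nat) (t : tree) : bool :=
  let: Node ts := t in (size ts <= Delta) && all (is_Ttree Delta) ts.

Inductive ltree := LNode of letter & seq ltree.

(* Label of the i-th (from 0) of the j children of an internal node. *)
Definition child_label (j i : nat) : letter :=
  if j == 1 then Ls
  else if i == 0 then Ll
  else if i == j.-1 then Lr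
  else Lm.

(* The label of a node depends on its parent, hence the root label a is passed
   as an argument. *)
Fixpoint label_with (t : tree) (a : letter) {struct t} : ltree :=
  let: Node ts := t in
  LNode a [seq p.1 p.2 |
    p <- zip (map label_with ts) (mkseq (child_label (size ts)) (size ts))].

Fixpoint preorder (t : ltree) : word :=
  let: LNode a ts := t in a :: flatten (map preorder ts).

Definition codeword (t : tree) : word := preorder (label_with t Ls).

(* In the last rule i = size ys + 2, x = x_1, ys = [:: x_2; ...; x_(i-1)] and
   z = x_i. *)
Inductive CodeSet (Delta : nat) : word -> Prop :=
| CodeSet_nil : CodeSet Delta [::]
| CodeSet_s (x : word) : CodeSet Delta x -> CodeSet Delta (Ls :: x)
| CodeSet_lmr (x : word) (ys : seq word) (z : word) :
    (size ys).+2 <= Delta ->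
    CodeSet Delta x ->
    (forall y, y \in ys -> CodeSet Delta y) ->
    CodeSet Delta z ->
    CodeSet Delta
      ((Ll :: x) ++ flatten [seq Lm :: y | y <- ys] ++ (Lr :: z)).

(* Main.v *)
Require Import Defs.
Local Open Scope classical_set_scope.

(** Dropping the root label from a codeword leaves the word [body t].  Words
    [body t] can be decoded from left to right: a node has a child iff the next
    letter is [s] or [l], and in a list of siblings the letters [m] and [r] tell
    whether a further sibling follows.  So [body t] is determined by any word
    that continues it with a letter other than [s] and [l]; this gives
    injectivity.  The recursive description of [body] matches the rules of the
    code set, which gives the image. *)

(** The induction principle generated for the nested type [tree] says nothing about the subtrees;
    here [Q] carries the hypothesis through the list of children. *)
Lemma tree_forest_ind (P : tree -> Prop) (Q : seq tree -> Prop) :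
  Q [::] ->
  (forall t ts, P t -> Q ts -> Q (t :: ts)) ->
  (forall ts, Q ts -> P (Node ts)) ->
  forall t, P t.
Proof.
move=> Q0 Qcons PNode; fix IH 1 => -[ts]; apply: PNode.
by elim: ts => [|t ts IHts]; [exact: Q0 | apply: Qcons; [exact: IH | exact: IHts]].
Qed.

Definition body (t : tree) : word := behead (codeword t).

Lemma preorder_label_with t a : preorder (label_with t a) = a :: body t.
Proof. by case: t. Qed.

Lemma codewordE t : codeword t = Ls :: body t.
Proof. exact: preorder_label_with. Qed.

(* The code of the children other than the leftmost one. *)
Fixpoint siblings (us : seq tree) : word :=
  if us is u :: us' then
    (if nilp us' then Lr else Lm) :: body u ++ siblings us'
  else [::].

(** The starting index [i] is free so that induction on [us] goes through. As [1 < n] excludes [Ls]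
    and [0 < i] excludes [Ll], a label depends only on whether the child is the last one. *)
Lemma flatten_preorder_siblings n i us : 0 < i -> i + size us = n -> 1 < n ->
  flatten (map preorder [seq p.1 p.2 |
    p <- zip (map label_with us) (map (child_label n) (iota i (size us)))])
  = siblings us.
Proof.
move=> i_gt0 + n_gt1; elim: us i i_gt0 => [|u us IHus] i i_gt0 //= def_n.
rewrite preorder_label_with IHus //; last by rewrite addSnnS.
congr (_ :: _); rewrite /child_label gtn_eqF // gtn_eqF // -def_n addnS /=.
by rewrite -[X in X == _]addn0 eqn_add2l eq_sym.
Qed.

Lemma body_nil : body (Node [::]) = [::].
Proof. by []. Qed.

Lemma body_cons t us :
  body (Node (t :: us)) =
  (if nilp us then Ls else Ll) :: body t ++ siblings us.
Proof.
rewrite {1}/body /codeword /= preorder_label_with /=.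
case: us => [|u us]; first by rewrite /= !cats0.
by rewrite flatten_preorder_siblings.
Qed.

(** Passes from the left-to-right recursion to the shape of the third rule of [CodeSet], which
    singles out the last child. *)
Lemma siblings_rcons us v :
  siblings (rcons us v) =
  flatten [seq Lm :: y | y <- map body us] ++ Lr :: body v.
Proof.
elim: us => [|u us IHus] /=; first by rewrite cats0.
by rewrite IHus -catA; case: us {IHus}.
Qed.

Definition opens_child (w : word) : bool :=
  if w is (Ls | Ll) :: _ then true else false.

Lemma opens_child_siblings us w :
  ~~ opens_child w -> ~~ opens_child (siblings us ++ w).
Proof. by case: us => [|u us] //= _; case: nilp. Qed.

Lemma opens_child_body_cons t us w : opens_child (body (Node (t :: us)) ++ w).
Proof. by rewrite body_cons; case: nilp. Qed.

Lemma body_cat_inj t t' w w' : ~~ opens_child w -> ~~ opens_child w' ->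
  body t ++ w = body t' ++ w' -> t = t' /\ w = w'.
Proof.
pose P t := forall t' w w', ~~ opens_child w -> ~~ opens_child w' ->
  body t ++ w = body t' ++ w' -> t = t' /\ w = w'.
(* Since [w] may begin with [Lm] or [Lr], the words alone do not show whether [us] is empty. The
   label just before them does, hence the hypothesis on [nilp]. *)
pose Q us := forall us' w w', ~~ opens_child w -> ~~ opens_child w' ->
  nilp us = nilp us' -> siblings us ++ w = siblings us' ++ w' ->
  us = us' /\ w = w'.
(* For a node with children [t :: us] the argument uses [P t] and [Q us], which are at hand while
   [Q (t :: us)] is being proved; so both claims are proved together. *)
pose R us := Q us /\ P (Node us).
suff: P t by apply.
move: t {t' w w'}; apply: (@tree_forest_ind P R) => [|t us IHt [IHus _]|us []//].
  split=> [[|u us] // w w' _ _ _ /= -> //|[[|u us]] w w' nw nw'].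
    by rewrite !body_nil.
  rewrite body_nil /= => def_w.
  by rewrite def_w opens_child_body_cons in nw.
split=> [[|u' us'] // w w' nw nw' _|[[|u' us']] w w' nw nw'].
- rewrite /= -!catA; case=> eq_lab eq_w.
  have [<- eq_w'] := IHt _ _ _ (opens_child_siblings us _ nw)
    (opens_child_siblings us' _ nw') eq_w.
  have eq_nilp : nilp us = nilp us' by move: eq_lab; do 2!case: nilp.
  by have [<-] := IHus _ _ _ nw nw' eq_nilp eq_w'.
- rewrite body_nil /= => def_w'.
  by rewrite -def_w' opens_child_body_cons in nw'.
rewrite !body_cons /= -!catA; case=> eq_lab eq_w.
have [<- eq_w'] := IHt _ _ _ (opens_child_siblings us _ nw)
  (opens_child_siblings us' _ nw') eq_w.
have eq_nilp : nilp us = nilp us' by move: eq_lab; do 2!case: nilp.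
by have [<-] := IHus _ _ _ nw nw' eq_nilp eq_w'.
Qed.

Lemma codeword_inj : injective codeword.
Proof.
move=> t t'; rewrite !codewordE => -[eq_body].
by have [] := @body_cat_inj t t' [::] [::]; rewrite ?eq_body.
Qed.

Lemma CodeSet_body Delta t : is_Ttree Delta t -> CodeSet Delta (body t).
Proof.
pose Q us := all (is_Ttree Delta) us ->
  forall y, y \in map body us -> CodeSet Delta y.
move: t; apply: (@tree_forest_ind _ Q) => [//|t us IHt IHus /andP[Tt Tus] y|].
  by rewrite inE => /predU1P[->|]; [exact: IHt | exact: IHus].
case=> [|t us] Qus /andP[le_us_Delta /Qus{}Qus].
  exact: CodeSet_nil.
have Ct : CodeSet Delta (body t) by apply: Qus; rewrite mem_head.
rewrite body_cons; case/lastP: us => [|us v] in le_us_Delta Qus *.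
  by rewrite cats0; apply: CodeSet_s.
rewrite siblings_rcons /nilp size_rcons /=; apply: CodeSet_lmr => //.
- by move: le_us_Delta; rewrite /= size_rcons size_map.
- move=> y us_y; apply: Qus.
  by rewrite map_cons map_rcons inE mem_rcons inE us_y !orbT.
- by apply: Qus; rewrite map_cons map_rcons inE mem_rcons mem_head orbT.
Qed.

(** Turns the induction hypothesis on the middle words of the third rule, which is stated word by
    word, into a single list of subtrees. *)
Lemma forest_of_bodies Delta (ys : seq word) :
  (forall y, y \in ys -> exists2 t, is_Ttree Delta t & body t = y) ->
  exists2 us, all (is_Ttree Delta) us & map body us = ys.
Proof.
elim: ys => [|y ys IHys] ex_t; first by exists [::].
have [t Tt <-] := ex_t y (mem_head _ _).
have [|us Tus <-] := IHys; first by move=> z ys_z; apply: ex_t; rewrite inE ys_z orbT.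
by exists (t :: us) => //=; apply/andP.
Qed.

Lemma CodeSet_body_surj Delta delta : 0 < Delta -> CodeSet Delta delta ->
  exists2 t, is_Ttree Delta t & body t = delta.
Proof.
move=> Delta_gt0; elim=> {delta} [|x _ [t Tt <-]|].
- by exists (Node [::]).
- by exists (Node [:: t]); rewrite ?body_cons ?cats0 //= Delta_gt0 Tt.
move=> x ys z le_ys_Delta _ [t Tt <-] _ /forest_of_bodies[us Tus def_ys] _ [v Tv <-].
(* The node has [(size ys).+2] children, which is the quantity bounded in the rule. *)
exists (Node (t :: rcons us v)).
  by rewrite /= size_rcons all_rcons Tt Tv Tus -(size_map body) def_ys le_ys_Delta.
by rewrite body_cons siblings_rcons def_ys /nilp size_rcons.
Qed.

Theorem theorem1 (Delta : nat) (hDelta : 2 <= Delta) :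
  set_bij [set t : tree | is_Ttree Delta t]
          [set Ls :: delta | delta in [set delta | CodeSet Delta delta]]
          codeword
  /\ (forall delta : word, CodeSet Delta delta ->
        exists! t : tree, is_Ttree Delta t /\ codeword t = Ls :: delta).
Proof.
have surj delta : CodeSet Delta delta ->
    exists2 t, is_Ttree Delta t & codeword t = Ls :: delta.
  move=> /(CodeSet_body_surj _ _ (ltnW hDelta))[t Tt <-].
  by exists t => //; exact: codewordE.
split; first split.
- by move=> t /= Tt; exists (body t); [exact: CodeSet_body | rewrite codewordE].
- by move=> t t' _ _; exact: codeword_inj.
- by move=> _ [delta /= /surj[t Tt <-] <-]; exists t.
move=> delta /surj[t Tt def_t]; exists t; split=> // t' [_ def_t'].
by apply: codeword_inj; rewrite def_t.
Qed.
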